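(* Let $p>3$ be a prime and let $i>1$ be an integer not divisible by $p$. Write $$\frac{(q^i;q^i)_\infty}{(q^p;q^p)_\infty}=\sum_{n\ge 0}a_nq^n .$$ For $0\le r\le p-1$ define $\mathcal{L}(r)$ as follows. If $p\equiv 1\pmod 3$: $$\mathcal{L}(r)=\begin{cases}6r^2+r & r\le \frac{4p-1}{12},\\ 6r^2+r-8pr+\frac{8p^2-2p}{3} & \frac{4p-1}{12}<r\le\frac{10p-1}{12},\\ 6r^2+r-12pr+6p^2-p & r>\frac{10p-1}{12};\end{cases}$$ if $p\equiv -1\pmod 3$: $$\mathcal{L}(r)=\begin{cases}6r^2+r & r\le \frac{2p-1}{12},\\ 6r^2+r-4pr+\frac{2p^2-p}{3} & \frac{2p-1}{12}<r\le\frac{8p-1}{12},\\ 6r^2+r-12pr+6p^2-p & r>\frac{8p-1}{12}.\end{cases}$$ Define $$N=N(p,i)=\max_{s}\ \min\{\, i\mathcal{L}(r) : 0\le r\le p-1,\ i\mathcal{L}(r)\equiv s \pmod p\,\}\;-\;p,$$ where the maximum is over those residues $s\in\{0,\dots,p-1\}$ for which the set is nonempty. Then for all $n>N$: (1) if $p\equiv 1\pmod 3$: $a_n>0$ if $n\equiv i(6r^2+r)\pmod p$ for some $0\le r\le p-1$ with $r\le\frac{4p-1}{12}$ or $r>\frac{10p-1}{12}$; $a_n<0$ if $n\equiv i(6r^2+r)\pmod p$ for some $0\le r\le p-1$ with $\frac{4p-1}{12}<r\le\frac{10p-1}{12}$; and $a_n=0$ if $n\not\equiv i(6r^2+r)\pmod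 p$ for every $r$; (2) if $p\equiv -1\pmod 3$: $a_n>0$ if $n\equiv i(6r^2+r)\pmod p$ for some $0\le r\le p-1$ with $r\le\frac{2p-1}{12}$ or $r>\frac{8p-1}{12}$; $a_n<0$ if $n\equiv i(6r^2+r)\pmod p$ for some $0\le r\le p-1$ with $\frac{2p-1}{12}<r\le\frac{8p-1}{12}$; and $a_n=0$ if $n\not\equiv i(6r^2+r)\pmod p$ for every $r$.
   Context: For $|q|<1$, $(a;q)_\infty=\prod_{k\ge0}(1-aq^k)$ and $(a_1,\dots,a_j;q)_\infty=(a_1;q)_\infty\cdots(a_j;q)_\infty$. All infinite products are expanded as formal power series in $q$. *)

(* Defs.v *)
From HB Require Import structures.
From mathcomp Require Import all_boot all_order all_algebra.
Set Implicit Arguments. Unset Strict Implicit. Unset Printing Implicit Defensive.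
Import Order.TTheory GRing.Theory Num.Theory.
Local Open Scope ring_scope.

(* Truncated product whose coefficient of q^n (for n < m) coincides with that of
   the formal power series (q^i;q^i)_oo / (q^p;q^p)_oo :
     prod_{k=1}^{m} (1 - q^{ik}) * prod_{k=1}^{m} (sum_{j=0}^{m} q^{pkj}).
   For i, p >= 1, the omitted factors/terms only involve exponents >= m+1. *)
Definition trunc_quot (p i m : nat) : {poly int} :=
  (\prod_(1 <= k < m.+1) (1 - 'X^(i * k))) *
  (\prod_(1 <= k < m.+1) (\sum_(0 <= j < m.+1) 'X^(p * k * j))).

Definition acoef (p i n : nat) : int := (trunc_quot p i n.+1)`_n.

Definition Lfun (p : nat) (r : nat) : int :=
  let P : int := p%:Z in let R : int := r%:Z in
  if (p %% 3 == 1)%N then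
    (if (12 * r <= 4 * p - 1)%N then 6 * R ^+ 2 + R
     else if (12 * r <= 10 * p - 1)%N
          then 6 * R ^+ 2 + R - 8 * P * R + ((8 * P ^+ 2 - 2 * P) %/ 3)%Z
     else 6 * R ^+ 2 + R - 12 * P * R + 6 * P ^+ 2 - P)
  else
    (if (12 * r <= 2 * p - 1)%N then 6 * R ^+ 2 + R
     else if (12 * r <= 8 * p - 1)%N
          then 6 * R ^+ 2 + R - 4 * P * R + ((2 * P ^+ 2 - P) %/ 3)%Z
     else 6 * R ^+ 2 + R - 12 * P * R + 6 * P ^+ 2 - P).

Definition Lset (p i s : nat) : seq int :=
  [seq (i%:Z * Lfun p r) | r <- iota 0 p & ((i%:Z * Lfun p r) %% p%:Z)%Z == s%:Z].

Definition seq_min (l : seq int) : int := foldr Num.min (head 0 l) l.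
Definition seq_max (l : seq int) : int := foldr Num.max (head 0 l) l.

Definition Nbound (p i : nat) : int :=
  seq_max [seq seq_min (Lset p i s) | s <- iota 0 p & Lset p i s != [::]] - p%:Z.

(* Main.v *)
Require Import Defs.
From HB Require Import structures.
From mathcomp Require Import all_boot all_order all_algebra.
From mathcomp Require Import zify ring.
Import Order.TTheory GRing.Theory Num.Theory.
Local Open Scope ring_scope.

(** By Euler, (q^i;q^i) is the sum over t in Z of (-1)^t q^(i t(3t-1)/2), and
    (q^p;q^p) only involves powers of q^p; so a_n only sees the t with
    i t(3t-1)/2 = n mod p.  Completing the square (24 t(3t-1)/2 + 1 = (6t-1)^2),
    such a class is empty or of the form t0 +- (pk +- j) with 0 <= 2j < p.
    With y = q^(ip), z = q^(ipj) the sum over a class is, up to sign and a power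
    of q, (y^p;y^p) if j = 0, and otherwise, by the quintuple product identity,
      (y^p, z^2, y^p/z^2; y^p) / (z, y^p/z; y^p).
    The numerator is a product of distinct factors 1 - q^(pa) with i | a, all of
    which cancel against 1/(q^p;q^p); as i > 1 the factor 1/(1 - q^p) survives,
    so every coefficient from the leading one on is nonzero, with the sign of
    the class.  The quintuple product identity itself follows from the triple
    product identity, by multiplying both sides with (y^p, z, y^p/z; y^p) and
    matching the terms of the resulting double sums.

    Power series are replaced by elements of a commutative ring in which x is
    nilpotent, so that all the series are finite sums. *)

(** * Sums of finitely supported families *)

Section FiniteSums.

Context {V : zmodType}.

(** The support list is existential, so no cut-off has to be carried along when sums are reindexed,
    multiplied or split. By [is_sum_unique], an identity follows from exhibiting both sides as sums
    of one family. *)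
Definition is_sum {I : eqType} (F : I -> V) (s : V) : Prop :=
  exists r : seq I, [/\ uniq r, (forall i, i \notin r -> F i = 0) &
                        s = \sum_(i <- r) F i].

Lemma is_sum_unique {I : eqType} (F : I -> V) s t :
  is_sum F s -> is_sum F t -> s = t.
Proof.
move=> [r [Ur Fr ->]] [r' [Ur' Fr' ->]].
rewrite (bigID (mem r')) /= [X in _ + X]big1 ?addr0; last by move=> i /Fr'.
rewrite [RHS](bigID (mem r)) /= [X in _ = _ + X]big1 ?addr0; last by move=> i /Fr.
rewrite -big_filter -[RHS]big_filter; apply: perm_big.
apply: uniq_perm; rewrite ?filter_uniq // => i.
by rewrite !mem_filter /= andbC.
Qed.

Lemma eq_is_sum {I : eqType} (F G : I -> V) s :
  F =1 G -> is_sum F s -> is_sum G s.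
Proof.
move=> FG [r [Ur Fr ->]]; exists r; split=> // [i /Fr|]; first by rewrite FG.
exact: eq_bigr.
Qed.

(** Reindexing along an injection that has to hit only the indices with nonzero terms; this is how
    terms outside a residue class are discarded later. *)
Lemma is_sum_image {I J : eqType} (h : I -> J) (F : J -> V) s :
  injective h -> (forall j, (exists i, j = h i) \/ F j = 0) ->
  is_sum (F \o h) s -> is_sum F s.
Proof.
move=> hinj hF [r [Ur Fr ->]]; exists (map h r); split.
- by rewrite map_inj_uniq.
- move=> j jr; case: (hF j) => // -[i ji]; rewrite ji; apply: Fr.
  by apply: contra jr => ir; rewrite ji map_f.
- by rewrite big_map.
Qed.

(** The retraction [h'] carries a support list back to [I]; [undup] removes the repetitions it may
    create. *)
Lemma is_sum_sub {I J : eqType} (h : I -> J) (h' : J -> I) (F : J -> V) s :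
  cancel h h' -> is_sum F s -> exists t, is_sum (F \o h) t.
Proof.
move=> hK [r [Ur Fr _]]; eexists; exists (undup (map h' r)); split=> //.
  exact: undup_uniq.
move=> i; rewrite mem_undup => ir; apply: Fr.
by apply: contra ir => hr; rewrite -(hK i) map_f.
Qed.

Lemma is_sum_bij {I J : eqType} (h : I -> J) (h' : J -> I) (F : J -> V) s :
  cancel h h' -> cancel h' h -> is_sum F s -> is_sum (F \o h) s.
Proof.
move=> hK h'K Fs; apply: (@is_sum_image _ _ h'); first exact: can_inj h'K.
  by move=> i; left; exists (h i); rewrite hK.
by apply: eq_is_sum Fs => j /=; rewrite h'K.
Qed.

Lemma is_sum_sum {I J : eqType} (F : I -> V) (G : J -> V) s t :
  is_sum F s -> is_sum G t ->
  is_sum (fun x : I + J => match x with inl i => F i | inr j => G j end) (s + t).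
Proof.
move=> [r [Ur Fr ->]] [r' [Ur' Gr ->]].
exists (map inl r ++ map inr r'); split.
- rewrite cat_uniq !map_inj_uniq ?Ur ?Ur' ?andbT /=; try by move=> ? ? [].
  by apply/hasPn => _ /mapP[j _ ->]; apply/mapP => -[].
- case=> k; rewrite mem_cat negb_or => /andP[k1 k2].
    by apply: Fr; apply: contra k1; exact: map_f.
  by apply: Gr; apply: contra k2; exact: map_f.
- by rewrite big_cat !big_map.
Qed.

End FiniteSums.

Lemma is_sum_additive {V W : zmodType} (f : {additive V -> W}) {I : eqType}
  (F : I -> V) s : is_sum F s -> is_sum (f \o F) (f s).
Proof.
move=> [r [Ur Fr ->]]; exists r; split=> // [i /Fr /= ->|]; first exact: raddf0.
exact: raddf_sum.
Qed.

Lemma is_sumM {R : pzRingType} {I J : eqType} (F : I -> R) (G : J -> R) s t :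
  is_sum F s -> is_sum G t ->
  is_sum (fun x : I * J => F x.1 * G x.2) (s * t).
Proof.
move=> [r [Ur Fr ->]] [r' [Ur' Gr ->]].
exists [seq (i, j) | i <- r, j <- r']; split.
- by apply: allpairs_uniq => // -[a b] [c d] _ _ /=.
- case=> i j /= /allpairsP ij.
  case: (boolP (i \in r)) => [ir|/Fr ->]; last by rewrite mul0r.
  case: (boolP (j \in r')) => [jr|/Gr ->]; last by rewrite mulr0.
  by case: ij; exists (i, j).
- rewrite big_distrl big_allpairs /=; apply: eq_bigr => i _.
  by rewrite big_distrr.
Qed.

Lemma is_sumZ {R : pzRingType} {I : eqType} (a : R) (F : I -> R) s :
  is_sum F s -> is_sum (fun i => a * F i) (a * s).
Proof.
move=> [r [Ur Fr ->]]; exists r; split=> // [i /Fr ->|]; first by rewrite mulr0.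
by rewrite big_distrr.
Qed.

(** * Triangular and pentagonal exponents, and signs *)

Lemma int_parity (k : int) : {h : int | k = h + h} + {h : int | k = h + h + 1}.
Proof.
case: (boolP (2 %| k)%Z) => hk; [left|right]; exists (k %/ 2)%Z; lia.
Qed.

(* The exponents k(k+1)/2 and k(3k-1)/2, natural numbers for every integer k. *)
Definition tri (k : int) : nat := `|((k * (k + 1)) %/ 2)%Z|%N.
Definition pent (k : int) : nat := (tri k + (tri (- k)).*2)%N.

Lemma triE k : (tri k)%:Z * 2 = k * (k + 1).
Proof.
rewrite /tri; have [[h ->]|[h ->]] := int_parity k.
  have -> : (h + h) * (h + h + 1) = (h * (h + h + 1)) * 2 by ring.
  rewrite mulzK // gez0_abs //; have [] : (0 <= h) \/ (h <= - 1) by lia.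
    by move=> h0; apply: mulr_ge0; lia.
  by move=> h0; rewrite -mulrNN; apply: mulr_ge0; lia.
have -> : (h + h + 1) * (h + h + 1 + 1) = ((h + 1) * (h + h + 1)) * 2 by ring.
rewrite mulzK // gez0_abs //; have [] : (0 <= h) \/ (h <= - 1) by lia.
  by move=> h0; apply: mulr_ge0; lia.
by move=> h0; rewrite -mulrNN; apply: mulr_ge0; lia.
Qed.

Lemma pentE k : (pent k)%:Z * 2 = k * (3 * k - 1).
Proof. rewrite /pent; have := triE k; have := triE (- k). lia. Qed.

Section Sign.
Context {R : pzRingType}.

(* (-1)^k for an integer k; [R] need not have inverses. *)
Definition altz (k : int) : R := if (2 %| k)%Z then 1 else - 1.

Lemma altzD m n : altz (m + n) = altz m * altz n.
Proof.
rewrite /altz; case: ifP => h1; case: ifP => h2; case: ifP => h3;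
  rewrite ?mulrNN ?mulr1 ?mul1r //; lia.
Qed.
Lemma altz_0 : altz 0 = 1. Proof. by []. Qed.
Lemma altz_1 : altz 1 = - 1. Proof. by []. Qed.

End Sign.

(** * Gaussian binomials and the finite triple product *)

Section Qbinomial.
Context {R : comPzRingType}.
Implicit Types (q u w : R) (n m l N K : nat).

(** A recursion instead of a quotient of q-factorials, as [R] has no division. For N' < K' the
    truncated subtraction is harmless, since it multiplies a binomial equal to 0. *)
Fixpoint qbin q N K : R :=
  match N, K with
  | _, 0%N => 1
  | 0%N, _.+1 => 0
  | N'.+1, K'.+1 => qbin q N' K'.+1 + q ^+ (N' - K') * qbin q N' K'
  end.

Lemma qbin0 q N : qbin q N 0 = 1. Proof. by case: N. Qed.

Lemma qbin_small q N K : (N < K)%N -> qbin q N K = 0.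
Proof.
elim: N K => [|N IH] [|K] //= h; rewrite !IH ?mulr0 ?addr0 //; lia.
Qed.

Lemma qbinS q N K : qbin q N.+1 K.+1 = qbin q N K.+1 + q ^+ (N - K) * qbin q N K.
Proof. by []. Qed.

Lemma qbinS' q N K : (K <= N)%N ->
  qbin q N.+1 K.+1 = qbin q N K + q ^+ K.+1 * qbin q N K.+1.
Proof.
elim: N K => [|N IH] K hK.
  have -> : K = 0%N by lia.
  by rewrite /=; ring.
rewrite qbinS; have [hKN|hKN] := ltnP N K.
  have -> : K = N.+1 by lia.
  by rewrite subnn mul1r !(@qbin_small _ _ N.+2) // mulr0 addr0 add0r.
have e1 : q ^+ K.+1 * q ^+ (N - K) = q ^+ N.+1 by rewrite -exprD; congr (_ ^+ _); lia.
rewrite [in LHS]IH // [in RHS]qbinS mulrDr mulrA e1.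
case: K hKN hK e1 => [|K] hKN hK e1.
  by rewrite !qbin0 subn0 mulr1; ring.
have e2 : q ^+ (N.+1 - K.+1) * q ^+ K.+1 = q ^+ N.+1.
  by rewrite -exprD; congr (_ ^+ _); lia.
rewrite [in LHS](IH K); last by lia.
by rewrite [in RHS](qbinS q N K) mulrDr mulrA e2 subSS; ring.
Qed.

Definition poch u q n : R := \prod_(k < n) (1 - u * q ^+ k).

Lemma poch0 u q : poch u q 0 = 1. Proof. exact: big_ord0. Qed.

Lemma pochS u q n : poch u q n.+1 = poch u q n * (1 - u * q ^+ n).
Proof. by rewrite /poch big_ord_recr. Qed.

Lemma qbin_poch q N K : (K <= N)%N ->
  qbin q N K * poch q q K * poch q q (N - K) = poch q q N.
Proof.
elim: N K => [|N IH] [|K] hK; rewrite ?qbin0 ?poch0 ?mul1r //.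
rewrite qbinS subSS.
have E1 := IH K hK.
have [hKN|hKN] := ltnP K N; last first.
  have e : K = N by lia.
  rewrite e subnn in E1 *; rewrite qbin_small // add0r expr0 mul1r pochS.
  by rewrite mulrA mulrAC E1.
have E2 := IH K.+1 hKN.
have e1 : (N - K = (N - K.+1).+1)%N by lia.
rewrite mulrDl mulrDl {1}e1 (pochS q q (N - _)) -exprS -e1.
rewrite mulrA E2 (pochS q q K) (pochS q q N) -!exprS.
have e3 : q ^+ N.+1 = q ^+ (N - K) * q ^+ K.+1 by rewrite -exprD; congr (_ ^+ _); lia.
rewrite e3 -E1; ring.
Qed.

(* With z = u and q = u w this is the term (-1)^k z^k q^(k(k-1)/2) of the triple
   product identity, in a form that needs no negative powers. *)
Definition jterm u w (k : int) : R := altz k * (u ^+ tri k * w ^+ tri (- k)).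

(** Induction on the number of factors, with q = [u * w]: a new factor 1 - u q^m is absorbed by the
    defining Pascal rule, a new factor 1 - w q^l by the mirror rule [qbinS']. *)
Lemma finite_triple_product u w m l :
  poch u (u * w) m * poch w (u * w) l =
  \sum_(K < (m + l).+1) qbin (u * w) (m + l) K * jterm u w (K%:Z - l%:Z).
Proof.
elim: l => [|l IHl]; [elim: m => [|m IHm]|].
- rewrite !poch0 big_ord_recr big_ord0 /= add0r !mul1r /jterm subrr oppr0.
  by rewrite altz_0 /tri mul0r div0z !expr0 !mulr1.
- rewrite !addn0 in IHm *.
  rewrite pochS mulrAC IHm mulrDr mulr1 mulrN.
  rewrite [RHS]big_ord_recl qbin0 mul1r [nat_of_ord ord0]/=.
  under [in RHS]eq_bigr => K _ do rewrite lift0 qbinS mulrDl.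
  rewrite big_split /= addrA.
  have -> : jterm u w (0%:Z - 0%:Z) + \sum_(K < m.+1) qbin (u * w) m K.+1 * jterm u w (K.+1%:Z - 0%:Z)
    = \sum_(K < m.+1) qbin (u * w) m K * jterm u w (K%:Z - 0%:Z).
    rewrite [in LHS]big_ord_recr /= (@qbin_small _ _ m.+1) // mul0r (addr0 (\sum_(_ < _) _)).
    by rewrite [in RHS]big_ord_recl qbin0 mul1r.
  congr (_ + _); rewrite mulr_suml -sumrN; apply: eq_bigr => K _.
  (* Term K + 1 is - u (uw)^K times term K. *)
  rewrite /jterm; have -> : K.+1%:Z - 0%:Z = (K%:Z - 0%:Z) + 1 by lia.
  rewrite (altzD _ 1) altz_1; set s := altz _.
  have -> : tri (K%:Z - 0 + 1) = (tri (K%:Z - 0) + K + 1)%N.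
    have := triE (K%:Z - 0 + 1); have := triE (K%:Z - 0). nia.
  have e : (tri (- (K%:Z - 0 + 1)) = tri (- (K%:Z - 0)) + K)%N.
    have := triE (- (K%:Z - 0 + 1)); have := triE (- (K%:Z - 0)). nia.
  rewrite e !exprD expr1.
  have -> : (u * w) ^+ m = (u * w) ^+ (m - K) * (u * w) ^+ K.
    rewrite -exprD; congr (_ ^+ _); have := ltn_ord K; lia.
  rewrite !exprMn; ring.
- rewrite !addnS pochS mulrA IHl mulrDr mulr1 mulrN.
  rewrite [RHS]big_ord_recl qbin0 mul1r [nat_of_ord ord0]/=.
  have -> : \sum_(K < (m + l).+1) qbin (u * w) (m + l).+1 (lift ord0 K) * jterm u w ((lift ord0 K)%:Z - l.+1%:Z)
    = \sum_(K < (m + l).+1) (qbin (u * w) (m + l) K * jterm u w (K%:Z - l%:Z) + (u * w) ^+ K.+1 * qbin (u * w) (m + l) K.+1 * jterm u w (K.+1%:Z - l.+1%:Z)).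
    apply: eq_bigr => K _; rewrite lift0 qbinS'; last by have := ltn_ord K; lia.
    by rewrite mulrDl; congr (_ * jterm _ _ _ + _); lia.
  rewrite big_split /= addrCA; congr (_ + _).
  transitivity (\sum_(K < (m + l).+1) (u * w) ^+ K * qbin (u * w) (m + l) K * jterm u w (K%:Z - l.+1%:Z)); last first.
    rewrite [in RHS]big_ord_recr /= (@qbin_small _ _ (m + l).+1) // mulr0 mul0r addr0.
    by rewrite [in LHS]big_ord_recl qbin0 expr0 !mul1r.
  rewrite mulr_suml -sumrN; apply: eq_bigr => K _.
  rewrite /jterm; have -> : K%:Z - l%:Z = (K%:Z - l.+1%:Z) + 1 by lia.
  rewrite (altzD _ 1) altz_1; set k := _ - _ : int; set s := altz _.
  (* Together with [e2]: w (uw)^l times term k + 1 is minus (uw)^K times term k. The exponents are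
     compared additively because k may be negative. *)
  have e1 : (tri (k + 1) + l = tri k + K)%N.
    have := triE (k + 1); have := triE k; rewrite /k. nia.
  have e2 : (tri (- (k + 1)) + l.+1 = tri (- k) + K)%N.
    have := triE (- (k + 1)); have := triE (- k); rewrite /k. nia.
  transitivity ((qbin (u * w) (m + l) K * s) *
     ((u ^+ tri (k + 1) * u ^+ l) * (w ^+ tri (- (k + 1)) * w ^+ l.+1))).
    by rewrite exprMn exprS; ring.
  rewrite -!exprD e1 e2 !exprD exprMn; ring.
Qed.

End Qbinomial.

(** * Infinite products at a nilpotent base *)

Section Nilpotent.
Context {R : comPzRingType} (M : nat).
Implicit Types (q u v w : R) (n : nat).

Lemma nilp_exp q n : q ^+ M = 0 -> (M <= n)%N -> q ^+ n = 0.
Proof. by move=> qM hn; rewrite -(subnK hn) exprD qM mulr0. Qed.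

Lemma nilp_mulr q u : q ^+ M = 0 -> (q * u) ^+ M = 0.
Proof. by move=> qM; rewrite exprMn qM mul0r. Qed.

Lemma nilp_expS q n : q ^+ M = 0 -> (0 < n)%N -> (q ^+ n) ^+ M = 0.
Proof. by case: n => // n qM _; rewrite exprS nilp_mulr. Qed.

(** The difference d satisfies d = q d, hence d = q^n d for every n, which is 0 for n = M. *)
Lemma nilp_cancel q u v : q ^+ M = 0 -> (1 - q) * u = (1 - q) * v -> u = v.
Proof.
move=> qM e; apply/eqP; rewrite -subr_eq0; apply/eqP; set d := u - v.
have {e} e : d = q * d by apply/eqP; rewrite -subr_eq0 -{1}[d]mul1r -mulrBl mulrBr e subrr.
have : forall n, d = q ^+ n * d.
  by elim=> [|n IH]; rewrite ?expr0 ?mul1r // exprS -mulrA -IH.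
by move=> /(_ M) ->; rewrite qM mul0r.
Qed.

Lemma poch_cancel q a n u v : a ^+ M = 0 -> poch a q n * u = poch a q n * v -> u = v.
Proof.
move=> aM; elim: n u v => [|n IH] u v; rewrite ?poch0 ?mul1r // pochS -!mulrA => /IH.
by apply: nilp_cancel; exact: nilp_mulr.
Qed.

(** Factors of index at least M are 1, so [poch u q M] plays the role of (u;q)_oo. *)
Lemma poch_stable q u n : q ^+ M = 0 -> (M <= n)%N -> poch u q n = poch u q M.
Proof.
move=> qM /subnK <-; elim: (n - M)%N => // k IH.
by rewrite addSn pochS (nilp_exp _ _ qM) ?leq_addl // mulr0 subr0 mulr1.
Qed.

(** The limit of the Gaussian binomials is 1/(q;q)_oo: with K and N - K at least M, the three
    products in [qbin_poch] share one stable value, which cancels once. *)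
Lemma qbin_nilp q N K : q ^+ M = 0 -> (M <= K)%N -> (K + M <= N)%N ->
  qbin q N K * poch q q M = 1.
Proof.
move=> qM h1 h2; apply: (poch_cancel q q M _ _ qM); rewrite mulr1.
have := qbin_poch q N K; rewrite !(poch_stable _ _ _ qM); try lia.
by move=> /(_ _) h; rewrite -[RHS]h; [ring|lia].
Qed.

Lemma jterm0 u w k : u ^+ M = 0 -> w ^+ M = 0 -> (M < `|k|)%N -> jterm u w k = 0.
Proof.
move=> uM wM hk; have [k0|k0] := lerP 0 k.
  rewrite /jterm (nilp_exp u (tri k)) ?mul0r ?mulr0 //; have := triE k; nia.
rewrite /jterm (nilp_exp w (tri (- k))) ?mul0r ?mulr0 //; have := triE (- k); nia.
Qed.

Lemma is_sum_bounded (F : int -> R) (B : nat) :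
  (forall k, (B < `|k|)%N -> F k = 0) ->
  is_sum F (\sum_(K < (B + B).+1) F (K%:Z - B%:Z)).
Proof.
move=> FB; exists [seq K%:Z - B%:Z | K <- iota 0 (B + B).+1]; split.
- by rewrite map_inj_uniq ?iota_uniq // => a b; lia.
- move=> k kr; apply: FB; rewrite ltnNge; apply: contra kr => kB.
  by apply/mapP; exists (absz (k + B%:Z)); rewrite ?mem_iota; lia.
- by rewrite big_map -[iota _ _]/(index_iota 0 (B + B).+1) big_mkord.
Qed.

Theorem triple_product u w : u ^+ M = 0 -> w ^+ M = 0 ->
  is_sum (jterm u w) (poch u (u * w) M * poch w (u * w) M * poch (u * w) (u * w) M).
Proof.
move=> uM wM; have qM : (u * w) ^+ M = 0 by exact: nilp_mulr.
(* Terms of index beyond M in absolute value vanish; for the others this B keeps both K and 2B - K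
   at least M, as [qbin_nilp] requires. *)
set B := (M + M + 1)%N.
have -> : poch u (u * w) M * poch w (u * w) M * poch (u * w) (u * w) M =
  \sum_(K < (B + B).+1) jterm u w (K%:Z - B%:Z).
  rewrite -(poch_stable _ u B qM) -?(poch_stable _ w B qM); try by rewrite /B; lia.
  rewrite finite_triple_product mulr_suml; apply: eq_bigr => K _.
  have [hK|hK] := ltnP M (absz (K%:Z - B%:Z)); first by rewrite jterm0 // mulr0 mul0r.
  by rewrite mulrAC qbin_nilp ?mul1r //; rewrite /B in hK *; lia.
by apply: is_sum_bounded => k hk; apply: jterm0 => //; rewrite /B in hk; lia.
Qed.

Lemma poch_trisect q n :
  poch q (q ^+ 3) n * poch (q ^+ 2) (q ^+ 3) n * poch (q ^+ 3) (q ^+ 3) n = poch q q (n * 3).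
Proof.
elim: n => [|n IH]; first by rewrite !poch0 !mulr1.
rewrite mulSn !addSn add0n !pochS -IH.
have e k : q ^+ (k + n * 3) = q ^+ k * (q ^+ 3) ^+ n.
  by rewrite exprD mulnC exprM.
have := (e 0%N, (e 1%N, e 2%N)); rewrite /addn /= => -[-> [-> ->]]; ring.
Qed.

(** The triple product at u = q, w = q^2, with base q^3: its three products interleave to
    (q;q)_oo. *)
Theorem pentagonal_number q : q ^+ M = 0 ->
  is_sum (fun t : int => altz t * q ^+ pent t) (poch q q M).
Proof.
move=> qM; have := triple_product q (q ^+ 2) qM (nilp_expS q 2 qM isT).
rewrite -exprS poch_trisect poch_stable //; last by lia.
by apply: eq_is_sum => t; rewrite /jterm -exprM mul2n -exprD.
Qed.

End Nilpotent.

(** * The quintuple product identity *)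

Section Quintuple.
Context {R : comPzRingType} (M : nat).
Implicit Types (u v : R) (n k m : int).

Lemma altz_congr (a b : int) : (2 %| a - b)%Z -> altz a = altz b :> R.
Proof. by rewrite /altz; case: ifP => h1; case: ifP => h2 //; lia. Qed.

Lemma altz_congrN (a b : int) : (2 %| a - b + 1)%Z -> altz a = - altz b :> R.
Proof. by move=> h; rewrite -mulN1r -altz_1 -altzD; apply: altz_congr; lia. Qed.

(* With z = u and q = u^2 v, these are (-1)^n q^(n(3n-1)/2) z^(3n) and
   (-1)^n q^(n(3n-1)/2) z^(1-3n). *)
Definition quint1 u v n : R := altz n * (u ^+ absz (3 * n ^+ 2 + 2 * n) * v ^+ pent n).
Definition quint2 u v n : R := altz n * (u ^+ absz (3 * n ^+ 2 - 4 * n + 1) * v ^+ pent n).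

Lemma quint1_exp_ge0 n : 0 <= 3 * n ^+ 2 + 2 * n.
Proof. nia. Qed.
Lemma quint2_exp_ge0 n : 0 <= 3 * n ^+ 2 - 4 * n + 1.
Proof. nia. Qed.

Let A u v n m : R := quint1 u v n * jterm u (u * v) m.
Let B u v n m : R := quint2 u v n * jterm u (u * v) m.
Let C u v (t k : int) : R := altz t * (u ^+ 2 * v) ^+ pent t * jterm (u ^+ 2) v k.

Let AE u v n m : A u v n m = altz (n + m) *
  (u ^+ (absz (3 * n ^+ 2 + 2 * n) + (tri m + tri (- m))) * v ^+ (pent n + tri (- m))).
Proof. by rewrite /A /quint1 /jterm altzD exprMn; move: (pent n) => a; rewrite !exprD; ring. Qed.
Let BE u v n m : B u v n m = altz (n + m) *
  (u ^+ (absz (3 * n ^+ 2 - 4 * n + 1) + (tri m + tri (- m))) * v ^+ (pent n + tri (- m))).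
Proof. by rewrite /B /quint2 /jterm altzD exprMn; move: (pent n) => a; rewrite !exprD; ring. Qed.
Let CE u v t k : C u v t k = altz (t + k) *
  (u ^+ (2 * pent t + 2 * tri k) * v ^+ (pent t + tri (- k))).
Proof. by rewrite /C /jterm altzD exprMn; move: (pent t) => a; rewrite -!exprM (exprD u) (exprD v); ring. Qed.

(* Grouping the double sums by the total power N of z: for N = 2k both match the
   product of the pentagonal series with the theta series in z^2 ([AC], [BC]), and
   for odd N they cancel ([AB]). *)
Let AC u v n k : A u v n (k + k - 3 * n) = C u v (k - 2 * n) k.
Proof.
rewrite AE CE; congr (_ * (_ ^+ _ * _ ^+ _)); first by apply: altz_congr; lia.
  have := quint1_exp_ge0 n; have := triE (k + k - 3 * n); have := triE (- (k + k - 3 * n)).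
  have := pentE (k - 2 * n); have := triE k; rewrite expr2; nia.
have := pentE n; have := triE (- (k + k - 3 * n)).
have := pentE (k - 2 * n); have := triE (- k); nia.
Qed.

Let BC u v n k : B u v n (k + k + 3 * n - 1) = C u v (1 - 2 * n - k) k.
Proof.
rewrite BE CE; congr (_ * (_ ^+ _ * _ ^+ _)); first by apply: altz_congr; lia.
  have := quint2_exp_ge0 n; have := triE (k + k + 3 * n - 1); have := triE (- (k + k + 3 * n - 1)).
  have := pentE (1 - 2 * n - k); have := triE k; rewrite expr2; nia.
have := pentE n; have := triE (- (k + k + 3 * n - 1)).
have := pentE (1 - 2 * n - k); have := triE (- k); nia.
Qed.

Let AB u v n k : A u v n (k + k + 1 - 3 * n) = - B u v (n - k) (k + k + 3 * (n - k)).
Proof.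
rewrite AE BE -[RHS]mulNr; congr (_ * (_ ^+ _ * _ ^+ _)); first by apply: altz_congrN; lia.
  have := quint1_exp_ge0 n; have := quint2_exp_ge0 (n - k); rewrite !expr2.
  have := triE (k + k + 1 - 3 * n); have := triE (- (k + k + 1 - 3 * n)).
  have := triE (k + k + 3 * (n - k)); have := triE (- (k + k + 3 * (n - k))).
  nia.
have := pentE n; have := pentE (n - k).
have := triE (- (k + k + 1 - 3 * n)); have := triE (- (k + k + 3 * (n - k))).
nia.
Qed.

Lemma is_sum_parity (F : int * int -> R) s : is_sum F s ->
  exists s0 s1, [/\ is_sum (fun x => F (x.1, x.2 + x.2)) s0,
    is_sum (fun x => F (x.1, x.2 + x.2 + 1)) s1 & s = s0 + s1].
Proof.
move=> Fs; pose half (x : int * int) := (x.1, (x.2 %/ 2)%Z).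
pose ev (x : int * int) := (x.1, x.2 + x.2); pose od (x : int * int) := (x.1, x.2 + x.2 + 1).
have evK : cancel ev half by case=> n k; rewrite /half /ev /=; congr (_, _); lia.
have odK : cancel od half by case=> n k; rewrite /half /od /=; congr (_, _); lia.
have [s0 F0] := is_sum_sub _ _ _ _ evK Fs; have [s1 F1] := is_sum_sub _ _ _ _ odK Fs.
exists s0, s1; split=> //; apply: is_sum_unique Fs _.
pose h (x : int * int + int * int) := match x with inl y => ev y | inr y => od y end.
apply: (is_sum_image h).
- case=> -[a b] [[c d]|[c d]] /= [-> e]; try (by exfalso; lia).
    by have -> : b = d by lia.
  by have -> : b = d by lia.
- case=> n m; left; have [[k ->]|[k ->]] := int_parity m; first by exists (inl (n, k)).
  by exists (inr (n, k)).
- by apply: eq_is_sum (is_sum_sum _ _ _ _ F0 F1); case.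
Qed.

Theorem quintuple_product u v (q := u ^+ 2 * v) : u ^+ M = 0 -> v ^+ M = 0 ->
  exists S1 S2 : R, [/\ is_sum (quint1 u v) S1, is_sum (quint2 u v) S2 &
    (S1 + S2) * (poch u q M * poch (u * v) q M)
      = poch q q M * (poch (u ^+ 2) q M * poch v q M)].
Proof.
move=> uM vM; have qM : q ^+ M = 0 by rewrite /q mulrC nilp_mulr.
have u2M : (u ^+ 2) ^+ M = 0 by exact: nilp_expS.
have v0 n : (M < `|n|)%N -> v ^+ pent n = 0.
  by move=> hn; apply: (nilp_exp M) => //; have := pentE n; nia.
have F1 := is_sum_bounded (quint1 u v) M (fun n hn =>
  etrans (congr1 (fun a => altz n * (_ * a)) (v0 n hn)) (etrans (congr1 _ (mulr0 _)) (mulr0 _))).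
have F2 := is_sum_bounded (quint2 u v) M (fun n hn =>
  etrans (congr1 (fun a => altz n * (_ * a)) (v0 n hn)) (etrans (congr1 _ (mulr0 _)) (mulr0 _))).
set S1 := \sum_(_ < _) _ in F1; set S2 := \sum_(_ < _) _ in F2.
exists S1, S2; split=> //.
have := triple_product M u (u * v) uM (nilp_mulr _ _ _ uM).
rewrite mulrA -expr2 -/q => J1.
have := triple_product M _ _ u2M vM; rewrite -/q => J2.
have hbij c : cancel (fun x : int * int => (x.1, x.2 + c x.1))
                   (fun x : int * int => (x.1, x.2 - c x.1)).
  by case=> a b /=; rewrite addrK.
have hbij' c : cancel (fun x : int * int => (x.1, x.2 - c x.1))
                    (fun x : int * int => (x.1, x.2 + c x.1)).
  by case=> a b /=; rewrite subrK.
(* The second index becomes the total power N of z, with N = m + 3n here and N = m + 1 - 3n for the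
   other double sum; N is then split by parity. *)
have /is_sum_parity[s0 [s1 [A0 A1 eA]]] :=
  is_sum_bij _ _ _ _ (hbij' (fun n => 3 * n)) (hbij (fun n => 3 * n)) (is_sumM _ _ _ _ F1 J1).
have /is_sum_parity[t0 [t1 [B0 B1 eB]]] :=
  is_sum_bij _ _ _ _ (hbij (fun n => 3 * n - 1)) (hbij' (fun n => 3 * n - 1)) (is_sumM _ _ _ _ F2 J1).
(* The parts with N odd cancel termwise after the shift of n by k found in [AB]. *)
have e1 : s1 = - t1.
  rewrite -mulN1r; apply: is_sum_unique A1 _.
  have kbij : cancel (fun x : int * int => (x.1 - x.2, x.2)) (fun x => (x.1 + x.2, x.2)).
    by case=> a b /=; rewrite subrK.
  have kbij' : cancel (fun x : int * int => (x.1 + x.2, x.2)) (fun x => (x.1 - x.2, x.2)).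
    by case=> a b /=; rewrite addrK.
  apply: eq_is_sum (is_sumZ (-1) _ _ (is_sum_bij _ _ _ _ kbij kbij' B1)) => -[n k] /=.
  rewrite mulN1r [RHS](AB u v n k) /B; congr (- (_ * jterm _ _ _)); lia.
have e0 : poch q q M * (poch (u ^+ 2) q M * poch v q M * poch q q M) = s0 + t0.
  apply: is_sum_unique (is_sumM _ _ _ _ (pentagonal_number M q qM) J2) _.
  (* The maps come from [AC] and [BC]: the first gives the pairs with k - t even, the second those
     with k - t odd, so each pair (t, k) is hit exactly once. *)
  pose h (x : int * int + int * int) := match x with
    inl y => (y.2 - 2 * y.1, y.2) | inr y => (1 - 2 * y.1 - y.2, y.2) end.
  apply: (is_sum_image h).
  - case=> -[a b] [[c d]|[c d]] /= [] + e; rewrite e => e'; try (by exfalso; lia).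
      by have -> : a = c by lia.
    by have -> : a = c by lia.
  - case=> t k; left; have [[n e]|[n e]] := int_parity (k - t).
      by exists (inl (n, k)); rewrite /h /=; congr (_, _); lia.
    by exists (inr (n + 1 - k, k)); rewrite /h /=; congr (_, _); lia.
  - apply: eq_is_sum (is_sum_sum _ _ _ _ A0 B0); case=> -[n k] /=.
      exact: AC.
    rewrite -[RHS](BC u v n k) /B; congr (_ * jterm _ _ _); lia.
apply: (poch_cancel M q q M _ _ qM).
have -> : poch q q M * ((S1 + S2) * (poch u q M * poch (u * v) q M)) =
  S1 * (poch u q M * poch (u * v) q M * poch q q M)
  + S2 * (poch u q M * poch (u * v) q M * poch q q M) by ring.
by rewrite eA eB e1 [_ + t1]addrC addrA subrK -e0; ring.
Qed.

End Quintuple.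

(** * Truncated power series and positivity *)

Lemma truncation_ring (A : comNzRingType) (M : nat) : (0 < M)%N ->
  exists (R : comNzRingType) (f : {rmorphism {poly A} -> R})
    (c : nat -> {additive R -> A}),
    f 'X ^+ M = 0 /\ forall k p, (k < M)%N -> c k (f p) = p`_k.
Proof.
(* The ring is A[X]/(X^M), and [c k] reads coefficient k of the reduced representative. *)
case: M => // M _; pose h : {poly A} := 'X^(M.+1).
have hE : mk_monic h = 'X^(M.+1) by rewrite mk_monic_Xn.
have add k : {morph (fun r : {poly %/ h} => (val r : {poly A})`_k) : x y / x - y}.
  by move=> x y /=; rewrite coefB.
pose c k : {additive {poly %/ h} -> A} := HB.pack (fun r : {poly %/ h} => (val r : {poly A})`_k)
  (GRing.isZmodMorphism.Build _ _ _ (add k)).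
exists {poly %/ h}, (in_qpoly h), c; split.
  rewrite -rmorphXn; apply: val_inj => /=; rewrite hE.
  by rewrite Pdiv.RingMonic.rmodpp ?monicXn.
move=> k p hk; rewrite /c /= hE.
rewrite [in RHS](Pdiv.RingMonic.rdivp_eq (monicXn A M.+1) p) coefD coefMXn hk.
by rewrite add0r.
Qed.

(** Constant term 1 is recorded besides nonnegativity so that a product with 1/(1 - X^p) has
    coefficients at least 1 at the multiples of p. *)
Definition pos_series (f : {poly int}) : Prop := (forall k, 0 <= f`_k) /\ f`_0 = 1.

Lemma pos_series1 : pos_series 1.
Proof. by split=> [k|]; rewrite coef1 //; case: k. Qed.

Lemma pos_seriesM f g : pos_series f -> pos_series g -> pos_series (f * g).
Proof.
move=> [f0 f1] [g0 g1]; split; last by rewrite coef0M f1 g1.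
by move=> k; rewrite coefM; apply: sumr_ge0 => j _; apply: mulr_ge0.
Qed.

Lemma pos_series_prod (I : Type) (r : seq I) (P : pred I) (F : I -> {poly int}) :
  (forall i, P i -> pos_series (F i)) -> pos_series (\prod_(i <- r | P i) F i).
Proof.
move=> FP; apply: big_ind FP; [exact: pos_series1 | exact: pos_seriesM].
Qed.

(** The factor of [trunc_quot] that stands for 1/(1 - X^a). *)
Definition geom (M a : nat) : {poly int} := \sum_(0 <= j < M.+1) 'X^(a * j).

Lemma coef_geom M a k : (geom M a)`_k = \sum_(0 <= j < M.+1) (k == (a * j)%N)%:R.
Proof. by rewrite /geom coef_sum; apply: eq_bigr => j _; rewrite coefXn. Qed.

Lemma geom_ge1 M a j : (j <= M)%N -> 1 <= (geom M a)`_(a * j).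
Proof.
move=> hj; rewrite coef_geom (bigD1_seq j) ?iota_uniq ?mem_index_iota //= eqxx.
by rewrite lerDl; apply: sumr_ge0 => i _; case: (_ == _).
Qed.

Lemma pos_series_geom M a : (0 < a)%N -> pos_series (geom M a).
Proof.
move=> a0; split=> [k|].
  by rewrite coef_geom; apply: sumr_ge0 => j _; case: (_ == _).
rewrite coef_geom big_nat_recl // muln0 eqxx big1 ?addr0 // => j _.
by rewrite eq_sym muln_eq0; case: a a0.
Qed.

(** * Cancellation against the partition product *)

Section Truncated.
Context {R : comNzRingType} (f : {rmorphism {poly int} -> R}) (M : nat).
Hypothesis fX : f 'X ^+ M = 0.
Let x := f 'X.

(** The product telescopes to 1 - x^(a(M+1)), and that power of x vanishes. *)
Lemma geom_unit a : (0 < a)%N -> (1 - x ^+ a) * f (geom M a) = 1.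
Proof.
move=> a0; rewrite /geom rmorph_sum big_mkord.
under eq_bigr => j _ do rewrite rmorphXn exprM.
rewrite -[1 - _]opprB mulNr -subrX1 opprB -exprM.
by rewrite (nilp_exp M) ?subr0 //; nia.
Qed.

Lemma geom_large a : (0 < a)%N -> (M <= a)%N -> f (geom M a) = 1.
Proof.
move=> a0 aM.
by have := geom_unit a a0; rewrite (nilp_exp M) // subr0 mul1r.
Qed.

(* [geom M (p * k)] stands for 1/(1 - x^(pk)): the distinct parts in [s] cancel, and
   the factor k = 1 is never cancelled. *)
Lemma prod_cancel_parts (p K : nat) (s : seq nat) :
  (0 < p)%N -> (M < K)%N -> uniq s -> (forall a, a \in s -> (1 < a < K)%N) ->
  \prod_(a <- s) (1 - (x ^+ p) ^+ a) * f (\prod_(1 <= k < M.+1) geom M (p * k)) =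
  f (geom M p * \prod_(2 <= k < K | k \notin s) geom M (p * k)).
Proof.
move=> p0 MK Us hs.
(* The product is lengthened up to K, so that it contains every part of [s]; the new factors are 1
   in [R]. *)
have -> : f (\prod_(1 <= k < M.+1) geom M (p * k)) = f (\prod_(1 <= k < K) geom M (p * k)).
  rewrite [in RHS](big_cat_nat (n := M.+1)) //= [in RHS]rmorphM.
  rewrite -[LHS]mulr1; congr (_ * _); symmetry.
  rewrite rmorph_prod big_nat_cond big1 // => k /andP[/andP[h1 h2] _].
  by apply: geom_large; nia.
(* K <= 1 forces M = 0; then 1 = x^0 = 0, and all elements of [R] are equal. *)
have [K1|K1] := ltnP 1 K; last first.
  have M0 : M = 0%N by lia.
  have R0 (r r' : R) : r = r'.
    by rewrite -[r]mulr1 -[r']mulr1 -(expr0 x) -{1 2}M0 fX !mulr0.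
  exact: R0.
rewrite big_ltn // muln1 !rmorphM mulrCA; congr (_ * _).
rewrite [\prod_(2 <= i < K) _](bigID (fun k => k \in s)) /= rmorphM mulrA.
rewrite -[RHS]mul1r; congr (_ * _).
have -> : \prod_(2 <= k < K | k \in s) geom M (p * k) = \prod_(k <- s) geom M (p * k).
  rewrite -big_filter; apply: perm_big; apply: uniq_perm => // [|k].
    by rewrite filter_uniq ?iota_uniq.
  rewrite mem_filter mem_index_iota; case: (boolP (k \in s)) => // /hs; lia.
rewrite rmorph_prod -big_split big_seq_cond big1 // => k /andP[/hs hk _] /=.
by rewrite -exprM geom_unit //; nia.
Qed.

Lemma poch_geom (p a b n : nat) : (0 < p)%N -> (0 < a)%N ->
  poch ((x ^+ p) ^+ a) ((x ^+ p) ^+ b) n * f (\prod_(k < n) geom M (p * (a + b * k))) = 1.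
Proof.
move=> p0 a0; rewrite /poch rmorph_prod -big_split big1 //= => k _.
by rewrite -!exprM -exprD -mulnA -mulnDr geom_unit //; nia.
Qed.

End Truncated.

(** * Positivity of the product quotients *)

Section Positivity.
Context {R : comNzRingType} (f : {rmorphism {poly int} -> R}) (M : nat).
Hypothesis fX : f 'X ^+ M = 0.
Context {p i : nat}.
Hypotheses (p0 : (0 < p)%N) (i1 : (1 < i)%N).
Let y := f 'X ^+ p.
Let partitions := f (\prod_(1 <= k < M.+1) geom M (p * k)).

Let yM : y ^+ M = 0. Proof. exact: nilp_expS. Qed.

Let poch_parts a : poch (y ^+ (i * a)) (y ^+ (i * p)) M =
  \prod_(k <- [seq (i * (a + p * k))%N | k <- iota 0 M]) (1 - y ^+ k).
Proof.
rewrite /poch -(big_mkord xpredT (fun k => 1 - y ^+ (i * a) * (y ^+ (i * p)) ^+ k)).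
rewrite big_map /index_iota subn0; apply: eq_bigr => k _.
by rewrite -exprM -exprD; congr (1 - _ ^+ _); rewrite mulnDr mulnA.
Qed.

Let parts_inj a : injective (fun k => (i * (a + p * k))%N).
Proof.
have i0 : (0 < i)%N by lia.
by move=> k l /eqP; rewrite eqn_pmul2l // eqn_add2l eqn_pmul2l // => /eqP.
Qed.

(** The lower bound is where i > 1 enters: no part is 1, so 1/(1 - x^p) is never cancelled. The
    upper bound is a convenient number beyond all parts and beyond M. *)
Let parts_bound a b : (0 < a)%N -> (a <= p)%N ->
  b \in [seq (i * (a + p * k))%N | k <- iota 0 M] -> (1 < b < i * p * M.+2 + M.+2)%N.
Proof.
move=> a0 ap /mapP[k]; rewrite mem_iota add0n => /= hk ->; rewrite mulnDr mulnA.
have : (i * p * k <= i * p * M)%N by rewrite leq_mul2l ltnW ?orbT.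
have : (i * a <= i * p)%N by rewrite leq_mul2l ap orbT.
rewrite !mulnS; nia.
Qed.

Lemma euler_quotient_pos : exists W, pos_series W /\
  poch (y ^+ (i * p)) (y ^+ (i * p)) M * partitions = f (geom M p * W).
Proof.
eexists; split; last first.
  rewrite poch_parts; apply: (prod_cancel_parts f M fX p (i * p * M.+2 + M.+2)) => //.
  - by lia.
  - by rewrite map_inj_uniq ?iota_uniq.
  - by move=> a; apply: parts_bound.
rewrite big_nat_cond; apply: pos_series_prod => k /andP[/andP[k2 _] _].
by apply: pos_series_geom; nia.
Qed.

(** The numerator of the quintuple product runs over parts i a with a congruent to 0, 2j or -2j
    modulo p, which cancel by [prod_cancel_parts]; the denominator contributes further geometric
    series. *)
Lemma quintuple_quotient_pos j : odd p -> (0 < j)%N -> (2 * j < p)%N ->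
  let u := y ^+ (i * j) in let v := y ^+ (i * (p - 2 * j)) in
  exists S1 S2 W, [/\ is_sum (quint1 u v) S1, is_sum (quint2 u v) S2, pos_series W &
    (S1 + S2) * partitions = f (geom M p * W)].
Proof.
move=> oddp j0 jp u v.
have uM : u ^+ M = 0 by apply: nilp_expS => //; lia.
have vM : v ^+ M = 0 by apply: nilp_expS => //; nia.
have [S1 [S2 [F1 F2 e]]] := quintuple_product M u v uM vM.
have qE : u ^+ 2 * v = y ^+ (i * p).
  by rewrite /u /v -exprM -exprD; congr (_ ^+ _); nia.
have wE : u * v = y ^+ (i * (p - j)).
  by rewrite /u /v -exprD; congr (_ ^+ _); nia.
have u2E : u ^+ 2 = y ^+ (i * (2 * j)).
  by rewrite /u -exprM; congr (_ ^+ _); nia.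
rewrite qE wE u2E /u /v in e.
pose D a := f (\prod_(k < M) geom M (p * (i * a + i * p * k))).
have DE a : (0 < a)%N -> poch (y ^+ (i * a)) (y ^+ (i * p)) M * D a = 1.
  by move=> a0; apply: poch_geom => //; lia.
pose s := [seq (i * (p + p * k))%N | k <- iota 0 M] ++
  ([seq (i * (2 * j + p * k))%N | k <- iota 0 M] ++
   [seq (i * (p - 2 * j + p * k))%N | k <- iota 0 M]).
(* The three families are disjoint, as 0, 2j and p - 2j are distinct modulo p, the last two because
   p is odd. *)
have Us : uniq s.
  have i0 : (0 < i)%N by lia.
  have neq a b k l : (a %% p != b %% p)%N -> (i * (a + p * k) != i * (b + p * l))%N.
    apply: contra; rewrite eqn_pmul2l // => /eqP e'.
    by rewrite -(modnMDl k) -(modnMDl l b) addnC mulnC e' addnC mulnC.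
  rewrite !cat_uniq !map_inj_uniq ?iota_uniq ?andbT //=.
  apply/andP; split; apply/hasPn => m.
    rewrite mem_cat => /orP[] /mapP[k _ ->]; apply/mapP => -[l _ /eqP]; apply/negP; apply: neq;
      rewrite modnn modn_small; lia.
  move=> /mapP[k _ ->]; apply/mapP => -[l _ /eqP]; apply/negP; apply: neq.
  rewrite !modn_small; lia.
have sP a : a \in s -> (1 < a < i * p * M.+2 + M.+2)%N.
  by rewrite !mem_cat => /or3P[]; apply: parts_bound; lia.
have MK : (M < i * p * M.+2 + M.+2)%N by lia.
have := prod_cancel_parts f M fX p _ s p0 MK Us sP.
rewrite !big_cat /= -!poch_parts -/y -/partitions.
set W := \prod_(_ <= _ < _ | _) _ => eW.
exists S1, S2, (W * (\prod_(k < M) geom M (p * (i * j + i * p * k)) *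
   \prod_(k < M) geom M (p * (i * (p - j) + i * p * k)))); split=> //.
  apply: pos_seriesM; last by apply: pos_seriesM; apply: pos_series_prod => k _;
    apply: pos_series_geom; nia.
  rewrite /W big_nat_cond; apply: pos_series_prod => k /andP[/andP[k2 _] _].
  by apply: pos_series_geom; nia.
rewrite mulrA !rmorphM -rmorphM -eW -/(D j) -/(D (p - j)%N) -e.
rewrite -[LHS]mulr1 -[X in _ * X]mulr1 -{1}(DE j j0) -(DE (p - j)%N); last by lia.
ring.
Qed.

End Positivity.

(** * Pentagonal numbers modulo p *)

Lemma pent_sq t : 24 * (pent t)%:Z + 1 = (6 * t - 1) ^+ 2.
Proof. by have := pentE t; rewrite expr2; lia. Qed.

(** Least absolute remainder, with the sign s kept apart so that j is a natural number; p odd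
    excludes the tie 2j = p. *)
Lemma centered_division (p : nat) (m : int) : odd p ->
  exists (k : int) (s : int) (j : nat),
    [/\ m = p%:Z * k + s * j%:Z, s = 1 \/ s = - 1 & (2 * j < p)%N].
Proof.
move=> oddp; have p0 : p%:Z != 0 by lia.
have e := divz_eq m p; have r0 := modz_ge0 m p0; have r1 := ltz_pmod m (d := p).
have {}r1 : (m %% p)%Z < p by apply: r1; lia.
have [h|h] := ltrP (2 * (m %% p)%Z) p%:Z.
  exists (m %/ p)%Z, 1, (absz (m %% p)%Z); split; [|by left|lia].
  by rewrite {1}e; lia.
exists ((m %/ p)%Z + 1), (-1), (absz (p%:Z - (m %% p)%Z)); split; [|by right|lia].
by rewrite {1}e; lia.
Qed.

Section Class.
Context {p : nat} {eps t0 : int}.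
Hypotheses (eps2 : eps = 1 \/ eps = - 1) (t0E : 6 * t0 = 1 - eps * p%:Z).

(** Since 6 t0 - 1 = - eps p, [t0] is the root of 6t - 1 modulo p and hence the centre of symmetry
    of the classes. Squaring removes eps. *)
Lemma pent_class (n s : int) (j : nat) : s = 1 \/ s = - 1 ->
  24 * (pent (t0 + eps * (p%:Z * n + s * j%:Z)))%:Z + 1
   = (p%:Z * (6 * n - 1) + 6 * s * j%:Z) ^+ 2.
Proof.
move=> s2; rewrite pent_sq.
have -> : 6 * (t0 + eps * (p%:Z * n + s * j%:Z)) - 1 =
  eps * (p%:Z * (6 * n - 1) + 6 * s * j%:Z).
  by rewrite mulrDr t0E; ring.
by rewrite exprMn; case: eps2 => ->; rewrite ?expr1n ?sqrrN ?expr1n mul1r.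
Qed.

(** The increments over the exponent at n = 0 are those of [quint1] at u = y^j, v = y^(p-2j) with y
    = x^p; [pent_class2] does the same for [quint2]. *)
Lemma pent_class1 n (j : nat) : (2 * j < p)%N ->
  pent (t0 + eps * (p%:Z * n + j%:Z)) =
   (pent (t0 + eps * j%:Z) + p * (j * absz (3 * n ^+ 2 + 2 * n)%R + (p - 2 * j) * pent n))%N.
Proof.
move=> hj.
have := pent_class n 1 j (or_introl erefl); have := pent_class 0 1 j (or_introl erefl).
rewrite mulr0 add0r mul1r => e1 e2; have e3 := quint1_exp_ge0 n; have e4 := pentE n.
apply/eqP; rewrite -eqz_nat PoszD !PoszM PoszD !PoszM -subzn; last lia.
rewrite gez0_abs // PoszM; apply/eqP; apply: (@mulfI _ 24) => //.
set P := p%:Z in e1 e2 *; set J := j%:Z in e1 e2 *; set a := (pent n)%:Z in e4 *.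
have -> : 24 * (pent (t0 + eps * (P * n + J)))%:Z = (P * (6 * n - 1) + 6 * 1 * J) ^+ 2 - 1 by lia.
rewrite [RHS]mulrDr; have -> : 24 * (pent (t0 + eps * J))%:Z = (P * (6 * 0 - 1) + 6 * 1 * J) ^+ 2 - 1 by lia.
have -> : 24 * (P * (J * (3 * n ^+ 2 + 2 * n) + (P - 2 * J) * a)) =
  24 * P * J * (3 * n ^+ 2 + 2 * n) + 12 * P * (P - 2 * J) * (a * 2) by ring.
rewrite e4; ring.
Qed.

Lemma pent_class2 n (j : nat) : (2 * j < p)%N ->
  pent (t0 + eps * (p%:Z * n - j%:Z)) =
   (pent (t0 + eps * j%:Z) + p * (j * absz (3 * n ^+ 2 - 4 * n + 1)%R + (p - 2 * j) * pent n))%N.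
Proof.
move=> hj.
have := pent_class n (-1) j (or_intror erefl); have := pent_class 0 1 j (or_introl erefl).
rewrite mulr0 add0r mul1r mulN1r => e1 e2; have e3 := quint2_exp_ge0 n; have e4 := pentE n.
apply/eqP; rewrite -eqz_nat PoszD !PoszM PoszD !PoszM -subzn; last lia.
rewrite gez0_abs // PoszM; apply/eqP; apply: (@mulfI _ 24) => //.
set P := p%:Z in e1 e2 *; set J := j%:Z in e1 e2 *; set a := (pent n)%:Z in e4 *.
have -> : 24 * (pent (t0 + eps * (P * n - J)))%:Z = (P * (6 * n - 1) + 6 * -1 * J) ^+ 2 - 1 by rewrite -e2 addrK.
rewrite [RHS]mulrDr; have -> : 24 * (pent (t0 + eps * J))%:Z = (P * (6 * 0 - 1) + 6 * 1 * J) ^+ 2 - 1 by lia.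
have -> : 24 * (P * (J * (3 * n ^+ 2 - 4 * n + 1) + (P - 2 * J) * a)) =
  24 * P * J * (3 * n ^+ 2 - 4 * n + 1) + 12 * P * (P - 2 * J) * (a * 2) by ring.
rewrite e4; ring.
Qed.

Hypotheses (pp : prime p) (p3 : (3 < p)%N).

Lemma dvd_dvd6 (m : int) : (p %| 6 * m)%Z -> (p %| m)%Z.
Proof.
have cop : coprime p 6.
  rewrite prime_coprime //; apply/negP => h.
  have : (p <= 6)%N by apply: dvdn_leq.
  by case: p p3 pp h => [|[|[|[|[|[|[|?]]]]]]].
by rewrite Gauss_dvdzr.
Qed.

(** The difference of the squares (6t - 1)^2 and (6 t1 - 1)^2 is 6(t - t1)(6(t + t1) - 2), and p
    divides one of the factors: t is congruent to t1 or to its reflection about [t0]. *)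
Lemma pent_class_inv (j : nat) (t : int) : (p %| (pent t)%:Z - (pent (t0 + eps * j%:Z))%:Z)%Z ->
  exists n, t = t0 + eps * (p%:Z * n + j%:Z) \/ t = t0 + eps * (p%:Z * n - j%:Z).
Proof.
set t1 := t0 + _ => h.
have {}h : (p %| 24 * (pent t)%:Z + 1 - (24 * (pent t1)%:Z + 1))%Z.
  have -> : 24 * (pent t)%:Z + 1 - (24 * (pent t1)%:Z + 1) =
            24 * ((pent t)%:Z - (pent t1)%:Z) by ring.
  exact: dvdz_mull.
have {}h : (p %| (6 * (t - t1)) * (6 * (t + t1) - 2))%Z.
  by move: h; rewrite !pent_sq; congr (_ %| _)%Z; ring.
have e2 : eps * eps = 1 by case: eps2 => ->.
have [h2|h2] : (p %| 6 * (t - t1))%Z \/ (p %| 6 * (t + t1) - 2)%Z.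
  by apply/orP; move: h; rewrite !dvdzE abszM Euclid_dvdM.
  have /dvdzP[k hk] := dvd_dvd6 _ h2; exists (eps * k); left.
  have -> : eps * (p%:Z * (eps * k) + j%:Z) = (eps * eps) * (k * p%:Z) + eps * j%:Z by ring.
  by rewrite e2 mul1r -hk /t1; ring.
(* Uses 12 t0 = 2 - 2 eps p. *)
have : (p %| 6 * (t - t0 + eps * j%:Z))%Z.
  have -> : 6 * (t - t0 + eps * j%:Z) = (6 * (t + t1) - 2) + 2 * (eps * p%:Z).
    by rewrite /t1; lia.
  by rewrite rpredD // mulrA dvdz_mull.
move/dvd_dvd6/dvdzP => [k hk]; exists (eps * k); right.
have -> : eps * (p%:Z * (eps * k) - j%:Z) = (eps * eps) * (k * p%:Z) - eps * j%:Z by ring.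
by rewrite e2 mul1r -hk; ring.
Qed.

End Class.

(** * The pentagonal series restricted to one residue class *)

Section ClassSum.
Context {R : comNzRingType} (f : {rmorphism {poly int} -> R}) (M : nat).
Hypothesis fX : f 'X ^+ M = 0.
Context {p i : nat} {eps t0 : int}.
Hypotheses (eps2 : eps = 1 \/ eps = - 1) (t0E : 6 * t0 = 1 - eps * p%:Z).
Hypotheses (pp : prime p) (p3 : (3 < p)%N) (i1 : (1 < i)%N).
Let x := f 'X.
Let partitions := f (\prod_(1 <= k < M.+1) geom M (p * k)).

Lemma class_sum (j : nat) (L := pent (t0 + eps * j%:Z)) : (2 * j < p)%N ->
  exists S W, [/\
    is_sum (fun t : int => if (p %| (pent t)%:Z - L%:Z)%Z then altz t * x ^+ (i * pent t) else 0)
      (altz (t0 + j%:Z) * x ^+ (i * L) * S),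
    pos_series W & S * partitions = f (geom M p * W)].
Proof.
move=> jp; have oddp : odd p by case: (even_prime pp) => // p2; lia.
have p0 : (0 < p)%N by lia.
(* As p, eps and s are odd, the index has the parity of t0 + j + n. *)
have altE (n s : int) : s = 1 \/ s = - 1 ->
    altz (t0 + eps * (p%:Z * n + s * j%:Z)) = altz (t0 + j%:Z) * altz n :> R.
  have [b ->] : exists b : nat, p = (2 * b + 1)%N by exists p./2; lia.
  by move=> s2; rewrite -altzD; apply: altz_congr; case: eps2 => ->; case: s2 => ->; lia.
have dvd k : (p %| (L + p * k)%N%:Z - L%:Z)%Z.
  by rewrite PoszD addrC addKr PoszM dvdz_mulr.
have term n s e : s = 1 \/ s = - 1 ->
    pent (t0 + eps * (p%:Z * n + s * j%:Z)) = (L + p * e)%N ->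
  (if (p %| (pent (t0 + eps * (p%:Z * n + s * j%:Z)))%:Z - L%:Z)%Z
   then altz (t0 + eps * (p%:Z * n + s * j%:Z)) * x ^+ (i * pent (t0 + eps * (p%:Z * n + s * j%:Z)))
   else 0) = altz (t0 + j%:Z) * x ^+ (i * L) * (altz n * (x ^+ p) ^+ (i * e)).
  move=> s2 ->; rewrite dvd altE // mulnDr exprD mulnCA (exprM x p).
  by ring.
(* For j = 0 the two progressions of [pent_class_inv] coincide and the sum is an Euler product. *)
have [j0|j0] := posnP j.
  have [W [Wpos eW]] := euler_quotient_pos f M fX p0 i1.
  exists (poch ((f 'X ^+ p) ^+ (i * p)) ((f 'X ^+ p) ^+ (i * p)) M), W; split=> //.
  apply: (is_sum_image (fun n => t0 + eps * (p%:Z * n + 1 * j%:Z))).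
  - move=> n m /addrI; case: eps2 => ->; rewrite j0; nia.
  - move=> t; case: ifP => h; last by right.
    left; have [n [->|->]] := pent_class_inv eps2 t0E pp p3 j t h; exists n;
    by rewrite j0 mulr0 ?subr0 ?addr0.
  have qM : ((f 'X ^+ p) ^+ (i * p)) ^+ M = 0.
    by apply: nilp_expS; [exact: nilp_expS | lia].
  apply: eq_is_sum (is_sumZ _ _ _ (pentagonal_number M _ qM)) => n /=.
  rewrite -(exprM (f 'X ^+ p)) -mulnA [RHS](term n 1 (p * pent n)%N (or_introl erefl)) //.
  by rewrite mul1r (pent_class1 eps2 t0E) // -/L j0 mul0n muln0 subn0 add0n.
have merge (y : R) a b c d :
    (y ^+ (i * a)) ^+ b * (y ^+ (i * c)) ^+ d = y ^+ (i * (a * b + c * d)).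
  by rewrite -!exprM -exprD mulnDr !mulnA.
have [S1 [S2 [W [F1 F2 Wpos eW]]]] := quintuple_quotient_pos f M fX p0 i1 j oddp j0 jp.
exists (S1 + S2), W; split=> //.
pose h (y : int + int) := match y with
  inl n => t0 + eps * (p%:Z * n + 1 * j%:Z) | inr n => t0 + eps * (p%:Z * n + - 1 * j%:Z) end.
apply: (is_sum_image h).
- have eps0 : eps != 0 by case: eps2 => ->.
  have pz : p%:Z != 0 by lia.
  (* The two progressions are disjoint: p (m - n) = 2j is impossible for 0 < 2j < p. *)
  have sep (n m : int) : p%:Z * n + 1 * j%:Z = p%:Z * m + - 1 * j%:Z -> False.
    move=> e; have {}e : p%:Z * (m - n) = 2 * j%:Z by lia.
    have [mn|mn] : m - n <= 0 \/ 1 <= m - n by lia.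
      by nia.
    by nia.
  case=> n [] m /addrI /(mulfI eps0).
  + by move=> /addIr /(mulfI pz) ->.
  + by move/sep.
  + by move/esym/sep.
  + by move=> /addIr /(mulfI pz) ->.
- move=> t; case: ifP => ht; last by right.
  left; have [n [->|->]] := pent_class_inv eps2 t0E pp p3 j t ht.
    by exists (inl n); rewrite /h mul1r.
  by exists (inr n); rewrite /h mulN1r.
apply: eq_is_sum (is_sumZ _ _ _ (is_sum_sum _ _ _ _ F1 F2)); case=> n /=.
  rewrite /quint1 merge; symmetry; apply: term; first by left.
  by rewrite mul1r (pent_class1 eps2 t0E).
rewrite /quint2 merge; symmetry; apply: term; first by right.
by rewrite mulN1r (pent_class2 eps2 t0E).
Qed.

End ClassSum.

(** * Coefficients of the quotient *)

Lemma eqn_mod_dvdz (d a b : nat) : (a == b %[mod d])%N = (d %| a%:Z - b%:Z)%Z.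
Proof. by rewrite -eqz_mod_dvd !modz_nat eqz_nat. Qed.

Section Coefficients.
Context {p i n : nat}.
Hypotheses (pp : prime p) (p3 : (3 < p)%N) (i1 : (1 < i)%N).
Let M := n.+1.
Let parts : {poly int} := \prod_(1 <= k < M.+1) geom M (p * k).

Lemma coef_parts_ndvd k : ~~ (p %| k)%N -> parts`_k = 0.
Proof.
move: k; apply: (big_ind (fun g : {poly int} => forall k, ~~ (p %| k)%N -> g`_k = 0)).
- by move=> [|k]; rewrite ?dvdn0 // coef1.
- move=> g h gP hP m pm; rewrite coefM big1 // => a _.
  have [pa|/gP ->] := boolP (p %| a)%N; last by rewrite mul0r.
  rewrite hP ?mulr0 //; apply: contra pm => pb.
  by rewrite -(subnK (ltn_ord a : a <= m)%N) dvdn_add.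
- move=> a _ m pm; rewrite coef_geom big1 // => b _.
  by case: eqP => // e; rewrite e -mulnA dvdn_mulr in pm.
Qed.

(** [parts] is a series in X^p, so terms of Euler's series outside the class of n never reach
    coefficient n. They may be replaced by 0 even though they need not vanish in [R]. *)
Lemma acoef_sum (R : comNzRingType) (f : {rmorphism {poly int} -> R})
    (c : {additive R -> int}) (S : R) :
  f 'X ^+ M = 0 -> (forall g, c (f g) = g`_n) ->
  is_sum (fun t : int => if (n == i * pent t %[mod p])%N
                         then altz t * f 'X ^+ (i * pent t) else 0) S ->
  acoef p i n = c (S * f parts).
Proof.
move=> fX cE FS.
have altf t : altz t = f (altz t) by rewrite /altz; case: ifP; rewrite ?rmorphN rmorph1.
have qM : (f 'X ^+ i) ^+ M = 0 by apply: nilp_expS => //; lia.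
have -> : acoef p i n = c (f parts * poch (f 'X ^+ i) (f 'X ^+ i) M).
  rewrite /acoef -cE /trunc_quot rmorphM mulrC; congr (c (_ * _)).
  rewrite rmorph_prod big_add1 big_mkord; apply: eq_bigr => k _.
  by rewrite rmorphB rmorph1 rmorphXn -exprM -exprD mulnS.
have := is_sum_additive c _ _ (is_sumZ (f parts) _ _ FS); rewrite [_ * S]mulrC.
apply: is_sum_unique.
apply: eq_is_sum (is_sum_additive c _ _ (is_sumZ (f parts) _ _ (pentagonal_number M _ qM))).
move=> t /=; rewrite -exprM; case: ifP => // /negbT ht.
rewrite mulr0 raddf0 altf -rmorphXn -!rmorphM cE.
rewrite mulrA coefMXn; case: ifP => // hn.
rewrite /altz; have := @coef_parts_ndvd (n - i * pent t).
rewrite -eqn_mod_dvd; last by lia.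
by move=> /(_ ht) h0; case: ifP => _; rewrite ?mulrN1 ?mulr1 ?coefN h0 ?oppr0.
Qed.

Lemma acoef_empty : (forall t, (n != i * pent t %[mod p])%N) -> acoef p i n = 0.
Proof.
move=> h; have [R [f [c [fX cE]]]] := truncation_ring int M isT.
rewrite (acoef_sum R f (c n) 0 fX) ?mul0r ?raddf0 //; first by move=> g; apply: cE.
by exists [::]; split=> // [t _|]; rewrite ?big_nil // (negbTE (h t)).
Qed.

Lemma acoef_class eps t0 j (L := pent (t0 + eps * j%:Z)) :
  eps = 1 \/ eps = - 1 -> 6 * t0 = 1 - eps * p%:Z -> ~~ (p %| i)%N -> (2 * j < p)%N ->
  (n = i * L %[mod p])%N -> (i * L <= n)%N -> 0 < altz (t0 + j%:Z) * acoef p i n.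
Proof.
move=> eps2 t0E pi jp nL Ln.
have [R [f [c [fX cE]]]] := truncation_ring int M isT.
have [S [W [FS [Wge W0] eW]]] := class_sum f M fX eps2 t0E pp p3 i1 j jp.
have altf t : altz t = f (altz t) by rewrite /altz; case: ifP; rewrite ?rmorphN rmorph1.
rewrite (acoef_sum R f (c n) _ fX (fun g => cE n g (ltnSn n)) (eq_is_sum _ _ _ _ FS)); last first.
  move=> t; congr (if _ then _ else _); rewrite nL eq_sym eqn_mod_dvdz !PoszM -mulrBr Gauss_dvdzr //.
  by rewrite coprimezE prime_coprime.
rewrite -!mulrA [S * f parts]eW altf -rmorphXn -!rmorphM cE //.
have /dvdnP[l el] : (p %| n - i * L)%N by rewrite -eqn_mod_dvd //; apply/eqP.
(* The truncated geometric series thus still contains X^(pl); times the constant term of [W] it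
   contributes at least 1. *)
have lM : (l <= M)%N by rewrite /M; nia.
have pos : 0 < ('X^(i * L) * (geom M p * W))`_n.
  rewrite coefXnM ltnNge Ln /= el mulnC coefM.
  have hl : (p * l < (p * l).+1)%N by [].
  rewrite (bigD1 (Ordinal hl)) //= subnn W0 mulr1.
  have := geom_ge1 M p l lM; have : 0 <= \sum_(k < (p * l).+1 | k != Ordinal hl) (geom M p)`_k * W`_(p * l - k).
    apply: sumr_ge0 => k _; apply: mulr_ge0 => //.
    by apply: (pos_series_geom M p _).1; lia.
  by move=> h1 h2; apply: ltr_wpDr => //; apply: lt_le_trans h2.
by rewrite /altz; case: ifP => _; rewrite ?mul1r ?mulN1r ?coefN ?opprK.
Qed.

End Coefficients.

(** * The bound N and the function L *)

Lemma seq_min_mem (l : seq int) : l != [::] -> seq_min l \in l.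
Proof.
have mem (a : int) (s : seq int) : foldr Num.min a s \in a :: s.
  elim: s => [|b s IH] /=; first by rewrite inE.
  rewrite minEle; case: ifP => _; rewrite !inE ?eqxx ?orbT //.
  by move: IH; rewrite inE => /orP[->|->]; rewrite ?orbT.
case: l => // a l _; have := mem a (a :: l).
by rewrite inE => /orP[/eqP e|//]; rewrite /seq_min -[foldr _ _ _]/(foldr Num.min a (a :: l)) e inE eqxx.
Qed.

Lemma seq_max_ge (l : seq int) (a : int) : a \in l -> a <= seq_max l.
Proof.
rewrite /seq_max; elim: l (head 0 l) => //= b l IH h.
by rewrite inE le_max => /orP[/eqP ->|/IH ->]; rewrite ?lexx ?orbT.
Qed.

(** The class of n is nonempty because of r, so its minimum is attained at some r' and enters the
    maximum defining N. *)
Lemma Nbound_witness (p i n r : nat) : (r < p)%N ->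
  ((i%:Z * Lfun p r) %% p)%Z = (n %% p)%N -> Nbound p i < n%:Z ->
  exists r', i%:Z * Lfun p r' - p%:Z < n%:Z /\
    ((i%:Z * Lfun p r') %% p)%Z = (n %% p)%N.
Proof.
move=> rp er hn; have Lr : i%:Z * Lfun p r \in Lset p i (n %% p).
  by apply/mapP; exists r; rewrite // mem_filter er eqxx mem_iota.
have ne : Lset p i (n %% p) != [::] by case: (Lset _ _ _) Lr.
have /mapP[r'] := seq_min_mem _ ne; rewrite mem_filter => /andP[/eqP er' _] e.
exists r'; split=> //; rewrite -e; apply: le_lt_trans hn.
rewrite lerD2r; apply: seq_max_ge; apply/mapP; exists (n %% p)%N => //.
by rewrite mem_filter ne mem_iota ltn_mod; lia.
Qed.

Lemma pent_even (r : int) : (pent (- 2 * r))%:Z = 6 * r ^+ 2 + r.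
Proof. by have := pentE (- 2 * r); rewrite expr2; nia. Qed.

(** Every branch satisfies 24 L + 1 = (12r + 1 - cp)^2, with c = 0 in the first, c = 12 in the last
    and c = 8 or 4 in the middle one; the witness t solves 6t - 1 = +-(12r + 1 - cp). *)
Lemma Lfun_pent (p r : nat) : (p %% 3 != 0)%N ->
  exists t, Lfun p r = pent t /\ (p %| Lfun p r - (6 * r%:Z ^+ 2 + r%:Z))%Z.
Proof.
move=> p3; rewrite /Lfun.
have first : exists t, 6 * r%:Z ^+ 2 + r%:Z = pent t /\
    (p %| 6 * r%:Z ^+ 2 + r%:Z - (6 * r%:Z ^+ 2 + r%:Z))%Z.
  by exists (- 2 * r%:Z); rewrite pent_even subrr dvdz0.
have last : exists t, 6 * r%:Z ^+ 2 + r%:Z - 12 * p%:Z * r%:Z + 6 * p%:Z ^+ 2 - p%:Z = pent t /\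
    (p %| 6 * r%:Z ^+ 2 + r%:Z - 12 * p%:Z * r%:Z + 6 * p%:Z ^+ 2 - p%:Z - (6 * r%:Z ^+ 2 + r%:Z))%Z.
  exists (- 2 * (r%:Z - p%:Z)); rewrite pent_even; split; first by ring.
  by apply/dvdzP; exists (- 12 * r%:Z + 6 * p%:Z - 1); ring.
(* The division by 3 in the middle branch is exact. *)
have third (a b : int) : a = b * 3 -> (a %/ 3)%Z = b by move=> ->; rewrite mulzK.
case: ifP => h3; case: ifP => // _; case: ifP => // _.
  have [w hw] : exists w : int, p%:Z = 3 * w + 1 by exists (p %/ 3)%N%:Z; lia.
  rewrite (third _ (p%:Z * (8 * w + 2))); last by rewrite hw; ring.
  exists (2 * r%:Z - 4 * w - 1); split; last first.
    by apply/dvdzP; exists (- 8 * r%:Z + (8 * w + 2)); ring.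
  apply: (@mulIf _ 2) => //; rewrite pentE hw; ring.
have [w hw] : exists w : int, p%:Z = 3 * w + 2 by exists (p %/ 3)%N%:Z; lia.
rewrite (third _ (p%:Z * (2 * w + 1))); last by rewrite hw; ring.
exists (2 * r%:Z - 2 * w - 1); split; last first.
  by apply/dvdzP; exists (- 4 * r%:Z + (2 * w + 1)); ring.
apply: (@mulIf _ 2) => //; rewrite pentE hw; ring.
Qed.

(** * Signs beyond the bound *)

Section Sign.
Context {p i n : nat} {eps t0 : int}.
Hypotheses (pp : prime p) (p3 : (3 < p)%N) (i1 : (1 < i)%N) (pi : ~~ (p %| i)%N).
Hypotheses (eps2 : eps = 1 \/ eps = - 1) (t0E : 6 * t0 = 1 - eps * p%:Z).
Hypothesis hn : Nbound p i < n%:Z.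

Let p_mod3 : (p %% 3 != 0)%N.
Proof. by apply/negP => h; move: (h); rewrite -/(3 %| p)%N dvdn_prime2 //; lia. Qed.

(* The class of n is that of t = -2r; writing -2r = t0 +- (pk +- j) with 2j < p, the
   sign of the class is that of (-1)^k, and k is read off the size of 12r + 1. *)
Lemma acoef_sign r : (r <= p - 1)%N -> (n = i * (6 * r ^ 2 + r) %[mod p])%N ->
  exists k s j, [/\ - 2 * r%:Z = t0 + eps * (p%:Z * k + s * j%:Z),
    s = 1 \/ s = - 1, (2 * j < p)%N & 0 < altz k * acoef p i n].
Proof.
move=> rp nr; have oddp : odd p by case: (even_prime pp) => // p2; lia.
have ee : eps * eps = 1 by case: eps2 => ->.
have [k [s [j [e s2 jp]]]] := centered_division p (eps * (- 2 * r%:Z - t0)) oddp.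
have {}e : - 2 * r%:Z = t0 + eps * (p%:Z * k + s * j%:Z).
  by rewrite -e mulrA ee mul1r addrC subrK.
exists k, s, j; split=> //.
pose L := pent (t0 + eps * j%:Z).
have pentL (m u : int) : u = 1 \/ u = - 1 ->
    exists a, pent (t0 + eps * (p%:Z * m + u * j%:Z)) = (L + p * a)%N.
  by case=> ->; rewrite ?mul1r ?mulN1r; eexists; [apply: pent_class1 | apply: pent_class2].
have [a ea] := pentL k s s2; rewrite -e in ea.
have rE : pent (- 2 * r%:Z) = (6 * r ^ 2 + r)%N.
  by apply/eqP; rewrite -eqz_nat pent_even; apply/eqP; rewrite expr2; nia.
have nL : (n = i * L %[mod p])%N.
  by rewrite nr -rE ea mulnDr mulnCA -modnDmr modnMr addn0.
(* As -2r is even while p, eps and s are odd, t0 + j and k have the same parity. *)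
have altk : altz (t0 + j%:Z) * altz k = 1 :> int.
  rewrite -altzD; transitivity (altz 0 : int) => //; apply: altz_congr.
  have [b pb] : exists b : nat, p = (2 * b + 1)%N by exists p./2; lia.
  have pk : p%:Z * k = 2 * (b%:Z * k) + k by rewrite pb; lia.
  move: e; rewrite pk; move: (b%:Z * k) => bk e {pb pk a ea rE nL pentL}.
  by clear -e eps2 s2; case: eps2 e => ->; case: s2 => ->; lia.
have altk' : altz k = altz (t0 + j%:Z) :> int.
  by move: altk; rewrite /altz; case: ifP; case: ifP.
rewrite altk'; apply: (acoef_class pp p3 i1 eps t0 j) => //; rewrite -/L.
have rltp : (r < p)%N by lia.
have [tr [_ Lr]] := Lfun_pent p r p_mod3.
have er : ((i%:Z * Lfun p r) %% p)%Z = (n %% p)%N.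
  rewrite nr -modz_nat; apply/eqP; rewrite eqz_mod_dvd PoszM -mulrBr; apply: dvdz_mull.
  by move: Lr; congr (_ %| _ - _)%Z; rewrite expr2; lia.
have [r' [lt_n er']] := Nbound_witness p i n r rltp er hn.
have [t [et _]] := Lfun_pent p r' p_mod3.
rewrite et in lt_n er'.
have ht : (p %| (pent t)%:Z - L%:Z)%Z.
  rewrite -(@Gauss_dvdzr p i); last by rewrite coprimezE prime_coprime.
  by rewrite mulrBr -eqz_mod_dvd er' nL -modz_nat PoszM.
(* [L] is the least pentagonal number of its class, the increments being natural numbers. *)
have Lt : (L <= pent t)%N.
  have [m tm] := pent_class_inv eps2 t0E pp p3 j t ht.
  have [u [u2 ->]] : exists u, (u = 1 \/ u = - 1) /\ t = t0 + eps * (p%:Z * m + u * j%:Z).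
    by case: tm => ->; [exists 1; rewrite mul1r; split; [left|] | exists (-1); rewrite mulN1r; split; [right|]].
  by have [b ->] := pentL m u u2; exact: leq_addr.
have {Lt} Lt : (i * L <= i * pent t)%N by rewrite leq_mul2l Lt orbT.
(* If n < iL, then iL - n is a positive multiple of p, so n <= iL - p <= i pent(t) - p < n. *)
rewrite leqNgt; apply/negP => nlt.
have /dvdnP[d ed] : (p %| i * L - n)%N.
  by rewrite -eqn_mod_dvd; [apply/eqP | exact: ltnW].
rewrite -PoszM in lt_n; move: nlt Lt lt_n ed; move: (i * L)%N (i * pent t)%N => A B.
clear; case: d => [|d]; rewrite ?mul0n ?mulSn; first by lia.
by move: (d * p)%N => dp; lia.
Qed.

End Sign.

Lemma acoef_vanish (p i n : nat) (pp : prime p) (p3 : (3 < p)%N) (i1 : (1 < i)%N) :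
  (forall r, (r <= p - 1)%N -> (n <> i * (6 * r ^ 2 + r) %[mod p])%N) -> acoef p i n = 0.
Proof.
move=> h; apply: acoef_empty => // t; apply/negP => /eqP nt.
have oddp : odd p by case: (even_prime pp) => // p2; lia.
have p0 : p%:Z != 0 by lia.
(* (p + 1)/2 inverts 2 modulo p, so t is congruent to -2r. *)
pose m := - t * ((p.+1 %/ 2)%N)%:Z.
pose r := absz (m %% p)%Z.
have rE : r%:Z = (m %% p)%Z by rewrite /r gez0_abs // modz_ge0.
have rp : (r < p)%N by have := ltz_pmod m (d := p); rewrite -rE; lia.
apply: (h r); first lia.
rewrite nt; apply/eqP; rewrite eqn_mod_dvdz !PoszM -mulrBr; apply: dvdz_mull.
have m2 : 2 * m = - t * (p%:Z + 1).
  have -> : p%:Z + 1 = 2 * (p.+1 %/ 2)%N%:Z by lia.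
  by rewrite /m; ring.
have tE : t = - 2 * r%:Z + p%:Z * (- t - 2 * (m %/ p)%Z).
  rewrite rE; move: m2; rewrite {1}(divz_eq m p).
  move: (m %% p)%Z (m %/ p)%Z (p%:Z) => r1 q1 p1; lia.
have -> : (6 * r ^ 2 + r)%N = pent (- 2 * r%:Z).
  by apply/esym/eqP; rewrite -eqz_nat pent_even; apply/eqP; rewrite expr2; nia.
rewrite {1}tE; move: (- t - _) => k.
rewrite -(@Gauss_dvdzr p 2); last by rewrite coprimezE coprimen2.
rewrite mulrBr ![2 * _]mulrC !pentE; apply/dvdzP.
exists (k * (3 * (- 4 * r%:Z + p%:Z * k) - 1)); ring.
Qed.

(** The choice of eps: p congruent to eps modulo 6 makes (1 - eps p)/6 an integer. The factors 1 and
    -1 stay visible to match [t0E]. *)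
Lemma residue_class6 (p : nat) : prime p -> (3 < p)%N ->
  (p %% 3 = 1)%N /\ (exists t0 : int, 6 * t0 = 1 - 1 * p%:Z) \/
  (p %% 3 = 2)%N /\ (exists t0 : int, 6 * t0 = 1 - -1 * p%:Z).
Proof.
move=> pp p3; have oddp : odd p by case: (even_prime pp) => // p2; lia.
have : (p %% 3 != 0)%N.
  by apply/negP => h; move: (h); rewrite -/(3 %| p)%N dvdn_prime2 //; lia.
case: (leqP (p %% 3) 1) => h1 h0; [left|right]; split; try lia.
  by exists (- (p %/ 6)%N%:Z); lia.
by exists ((p %/ 6)%N%:Z + 1); lia.
Qed.

Theorem theorem1p1 (p i : nat) (hp : prime p) (hp3 : (3 < p)%N) (hi : (1 < i)%N)
  (hpi : ~~ (p %| i)%N) (n : nat) (hn : Nbound p i < n%:Z) :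
  ((p %% 3 = 1)%N ->
     ((exists r : nat, [/\ (r <= p - 1)%N,
          ((12 * r <= 4 * p - 1)%N \/ (10 * p - 1 < 12 * r)%N)
          & n = i * (6 * r ^ 2 + r) %[mod p]]) -> 0 < acoef p i n) /\
     ((exists r : nat, [/\ (r <= p - 1)%N,
          (4 * p - 1 < 12 * r)%N /\ (12 * r <= 10 * p - 1)%N
          & n = i * (6 * r ^ 2 + r) %[mod p]]) -> acoef p i n < 0) /\
     ((forall r : nat, (r <= p - 1)%N -> n <> i * (6 * r ^ 2 + r) %[mod p]) ->
        acoef p i n = 0)) /\
  ((p %% 3 = 2)%N ->
     ((exists r : nat, [/\ (r <= p - 1)%N,
          ((12 * r <= 2 * p - 1)%N \/ (8 * p - 1 < 12 * r)%N)
          & n = i * (6 * r ^ 2 + r) %[mod p]]) -> 0 < acoef p i n) /\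
     ((exists r : nat, [/\ (r <= p - 1)%N,
          (2 * p - 1 < 12 * r)%N /\ (12 * r <= 8 * p - 1)%N
          & n = i * (6 * r ^ 2 + r) %[mod p]]) -> acoef p i n < 0) /\
     ((forall r : nat, (r <= p - 1)%N -> n <> i * (6 * r ^ 2 + r) %[mod p]) ->
        acoef p i n = 0)).
Proof.
have vanish := acoef_vanish p i n hp hp3 hi.
have altP (k a : int) : (2 %| k)%Z -> 0 < altz k * a -> 0 < a.
  by rewrite /altz => ->; rewrite mul1r.
have altN (k a : int) : ~~ (2 %| k)%Z -> 0 < altz k * a -> a < 0.
  by rewrite /altz => /negbTE ->; rewrite mulN1r oppr_gt0.
split=> pm; case: (residue_class6 p hp hp3) => -[pm' [t0 t0E]];
  try (by rewrite pm in pm').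
- have sign := acoef_sign hp hp3 hi hpi (or_introl erefl) t0E hn.
  (* By 6j < 3p, 12r + 1 lies strictly between (-6k - 2)p and (-6k + 4)p. This yields the thresholds
     4p and 10p, with k odd exactly in the middle range. *)
  have range r k s (j : nat) : - 2 * r%:Z = t0 + 1 * (p%:Z * k + s * j%:Z) ->
      s = 1 \/ s = -1 -> (2 * j < p)%N -> (r <= p - 1)%N ->
      [\/ k = 0 /\ (12 * r <= 4 * p - 1)%N,
          k = -1 /\ (4 * p - 1 < 12 * r <= 10 * p - 1)%N |
          k = -2 /\ (10 * p - 1 < 12 * r)%N].
    move=> e s2 jp rp.
    have e12 : 12 * r%:Z + 1 = p%:Z - 6 * (p%:Z * k) - 6 * (s * j%:Z) by lia.
    have sj : - p%:Z < 2 * (s * j%:Z) < p%:Z by case: s2 => ->; lia.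
    have k0 : k <= 0 by nia.
    have k2 : - 2 <= k by nia.
    have [kE|[kE|kE]] : k = 0 \/ k = -1 \/ k = -2 by lia.
    + by constructor 1; rewrite kE in e12 *; lia.
    + by constructor 2; rewrite kE in e12 *; lia.
    + by constructor 3; rewrite kE in e12 *; lia.
  split; [|split] => //.
    move=> [r [rp hr nr]]; have [k [s [j [e s2 jp pos]]]] := sign r rp nr.
    by apply: (altP k) => //; case: (range r k s j e s2 jp rp) => -[-> ?] //; lia.
  move=> [r [rp [hr hr'] nr]]; have [k [s [j [e s2 jp pos]]]] := sign r rp nr.
  by apply: (altN k) => //; case: (range r k s j e s2 jp rp) => -[-> ?] //; lia.
- have sign := acoef_sign hp hp3 hi hpi (or_intror erefl) t0E hn.
  (* Here 12r + 1 lies strictly between (6k - 4)p and (6k + 2)p, hence the thresholds 2p and 8p. *)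
  have range r k s (j : nat) : - 2 * r%:Z = t0 + -1 * (p%:Z * k + s * j%:Z) ->
      s = 1 \/ s = -1 -> (2 * j < p)%N -> (r <= p - 1)%N ->
      [\/ k = 0 /\ (12 * r <= 2 * p - 1)%N,
          k = 1 /\ (2 * p - 1 < 12 * r <= 8 * p - 1)%N |
          k = 2 /\ (8 * p - 1 < 12 * r)%N].
    move=> e s2 jp rp.
    have e12 : 12 * r%:Z + 1 = - p%:Z + 6 * (p%:Z * k) + 6 * (s * j%:Z) by lia.
    have sj : - p%:Z < 2 * (s * j%:Z) < p%:Z by case: s2 => ->; lia.
    have k0 : 0 <= k by nia.
    have k2 : k <= 2 by nia.
    have [kE|[kE|kE]] : k = 0 \/ k = 1 \/ k = 2 by lia.
    + by constructor 1; rewrite kE in e12 *; lia.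
    + by constructor 2; rewrite kE in e12 *; lia.
    + by constructor 3; rewrite kE in e12 *; lia.
  split; [|split] => //.
    move=> [r [rp hr nr]]; have [k [s [j [e s2 jp pos]]]] := sign r rp nr.
    by apply: (altP k) => //; case: (range r k s j e s2 jp rp) => -[-> ?] //; lia.
  move=> [r [rp [hr hr'] nr]]; have [k [s [j [e s2 jp pos]]]] := sign r rp nr.
  by apply: (altN k) => //; case: (range r k s j e s2 jp rp) => -[-> ?] //; lia.
Qed.
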